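(* Let $F:\mathbb{R}\to\mathcal{CC}(\mathbb{R})$ be relaxed one-sided Lipschitz with constant $l<0$ and $L$-Lipschitz, and let $x_0\in\mathbb{R}$ and $\bar y\in\mathbb{R}$ be given. If $L\le-2l$, then the iteration \[x_{n+1}:=x_n+\frac12\Big(\frac1l-\frac1L\Big)\big(\bar y-\mathrm{Proj}(\bar y,F(x_n))\big)\] converges to a solution $\bar x\in S_F(\bar y):=\{x\in\mathbb{R}:\ \bar y\in F(x)\}$ and satisfies \[\mathrm{dist}(x_n,S_F(\bar y))\le-\frac{1}{2l}\,\kappa^{n-1}\,\mathrm{dist}(\bar y,F(x_0))\] and \[|x_n-\bar x|\le\frac12\Big(\frac1L-\frac1l\Big)\frac{\kappa^n}{1-\kappa}\,\mathrm{dist}(\bar y,F(x_0))\] for $n\ge1$, where $\kappa:=-\frac12\big(1+\frac{L}{l}\big)$.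
   Context: $\mathcal{CC}(\mathbb{R})$ is the family of nonempty compact convex subsets of $\mathbb{R}$ (compact intervals). For sets $A,B$, $\mathrm{dist}(A,B):=\sup_{a\in A}\inf_{b\in B}|a-b|$ (for a point $y$, $\mathrm{dist}(y,B):=\inf_{b\in B}|y-b|$) and $\mathrm{dist}_H(A,B):=\max\{\mathrm{dist}(A,B),\mathrm{dist}(B,A)\}$. For $y\in\mathbb{R}$ and $A\in\mathcal{CC}(\mathbb{R})$, $\mathrm{Proj}(y,A)$ is the unique point of $A$ with $|y-\mathrm{Proj}(y,A)|=\mathrm{dist}(y,A)$. A map $F:\mathbb{R}\to\mathcal{CC}(\mathbb{R})$ is: $L$-Lipschitz, with $L\ge0$, if $\mathrm{dist}_H(F(x),F(x'))\le L|x-x'|$ for all $x,x'\in\mathbb{R}$; relaxed one-sided Lipschitz with constant $l\in\mathbb{R}$ ($l$-ROSL) if for any $x,x'\in\mathbb{R}$ and $y\in F(x)$ there exists $y'\in F(x')$ with $(y-y')(x-x')\le l|x-x'|^2$. Convention: $\kappa^0=1$. *)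

(* Defs.v *)
From HB Require Import structures.
From mathcomp Require Import all_boot all_order all_algebra.
From mathcomp Require Import ring lra.
From mathcomp Require Import all_classical all_reals all_analysis.

Set Implicit Arguments.
Unset Strict Implicit.
Unset Printing Implicit Defensive.

Import Order.TTheory GRing.Theory Num.Theory.
Import numFieldNormedType.Exports.

Local Open Scope classical_set_scope.
Local Open Scope ring_scope.

Section SetValuedMaps.
Context {R : realType}.
Implicit Types (A B : set R) (F : R -> set R) (x y l L : R).

Definition nonempty_compact_convex A :=
  [/\ A !=set0, compact A & @convex_set R R^o A].

(* [inf] and [sup] are the real-valued ones, equal to 0 on the empty set.
   [dist_pt y B] is the true infimum whenever [B] is nonempty, and [dist A B]
   the true supremum whenever moreover [A] is nonempty and bounded. *)
Definition dist_pt y B : R := inf [set `|y - b| | b in B].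

Definition dist A B : R := sup [set dist_pt a B | a in A].

Definition dist_H A B : R := Num.max (dist A B) (dist B A).

(* The default value [y] is irrelevant for nonempty compact convex [A];
   see [Proj_spec] and [Proj_unique]. *)
Definition Proj y A : R := xget y [set p | A p /\ `|y - p| = dist_pt y A].

Definition Lipschitz_map L F :=
  0 <= L /\ forall x x', dist_H (F x) (F x') <= L * `|x - x'|.

Definition ROSL l F := forall x x' y, F x y ->
  exists2 y', F x' y' & (y - y') * (x - x') <= l * `|x - x'| ^+ 2.

Definition solution_set F y : set R := [set x | F x y].

Lemma Proj_spec y A : nonempty_compact_convex A ->
  A (Proj y A) /\ `|y - Proj y A| = dist_pt y A.
Proof.
case=> A0 cA _; pose f a := `|y - a|.
have cf : continuous f.
  by move=> a; apply: cvg_norm; apply: cvgB; [exact: cvg_cst|exact: cvg_id].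
have [c Ac cmin] : exists2 c, A c & forall t, A t -> f c <= f t.
  have [c Ac cmin] := compact_EVT_min A0 cA (continuous_subspaceT cf).
  exists c; first by rewrite inE in Ac.
  by move=> t At; apply: cmin; rewrite inE.
apply: (@xgetI _ y [set p | A p /\ `|y - p| = dist_pt y A] c); split=> //.
apply/eqP; rewrite eq_le; apply/andP; split.
  by apply: lb_le_inf; [exists (f c), c|move=> _ [t At <-]; exact: cmin].
by apply: ge_inf; [exists 0 => _ [t _ <-]; exact: normr_ge0|exists c].
Qed.

Lemma Proj_unique y A p : nonempty_compact_convex A ->
  A p -> `|y - p| = dist_pt y A -> p = Proj y A.
Proof.
move=> hA Ap ep; have [Aq eq] := Proj_spec y hA.
set q := Proj y A in Aq eq *; case: hA => _ _ convA.
have h0 : 0 <= 2^-1 :> R by lra.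
have h1 : 2^-1 <= 1 :> R by lra.
have Am : A (2^-1 * p + (1 - 2^-1) * q).
  have := convA p q (Itv01 h0 h1); rewrite !inE; exact.
have : dist_pt y A <= `|y - (2^-1 * p + (1 - 2^-1) * q)|.
  by apply: ge_inf; [exists 0 => _ [t _ <-]; exact: normr_ge0|eexists; eauto].
have := normr_ge0 (y - p); rewrite ep.
move: ep eq; case: (ler0P (y - p)) => ?; case: (ler0P (y - q)) => ?;
case: (ler0P (y - _)) => ?; lra.
Qed.

End SetValuedMaps.

(* Main.v *)
Require Import Defs.
From HB Require Import structures.
From mathcomp Require Import all_boot all_order all_algebra.
From mathcomp Require Import ring lra.
From mathcomp Require Import all_classical all_reals all_analysis.

(** Write [g t = ybar - Proj ybar (F t)] for the residual, [m = - l], and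
    [c = (1 / m + 1 / L) / 2].  The iteration is [x' = x - c * g x], its
    targets are the zeros of [g], and [`|g t|] is the distance from [ybar] to
    [F t]; so everything reduces to a real function.

    Since [F t] is an interval, the residual is zero or, up to sign, the
    distance of [ybar] to one endpoint. The Lipschitz condition makes [g]
    Lipschitz with constant [L] ([residual_lipschitz]). The one-sided
    condition makes both endpoints decrease at rate at least [m], hence [g]
    increase at rate at least [m] as long as it does not vanish
    ([residual_expansive]). In particular [m <= L] ([ROSL_constant_le]), so
    [L] is positive and [kappa] is nonnegative; the hypothesis [L <= 2 * m]
    gives [kappa <= 1 / 2].

    To the left of a point with [0 < g x], the two rates locate a zero between
    [x - g x / m] and [x - g x / L].  The iteration jumps to the midpoint of
    these bounds, so it lands within [g x / (2 * m)] of a solution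
    ([zero_near_step]), and the rates bound the new residual by [kappa * g x],
    whether or not the step overshoots ([residual_contraction]).  Residuals thus
    decay like [kappa ^+ n], and so do the increments of the sequence; a
    geometric tail estimate ([geometric_increments_cvg]) yields the limit and
    the second bound, and continuity of [g] shows that the limit is a
    solution. *)

Set Implicit Arguments.
Unset Strict Implicit.
Unset Printing Implicit Defensive.

Import Order.TTheory GRing.Theory Num.Theory.
Import numFieldNormedType.Exports.

Local Open Scope classical_set_scope.
Local Open Scope ring_scope.

(** * Distances and projections for compact intervals *)

Lemma dist_pt_le (R : realType) (y a : R) (A : set R) :
  A a -> dist_pt y A <= `|y - a|.
Proof.
move=> Aa; apply: ge_inf; last by exists a.
by exists 0 => _ [b _ <-].
Qed.

Lemma convex_segment (R : realType) (A : set R) (p a t : R) :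
  @convex_set R R^o A -> A p -> A a -> 0 <= t <= 1 -> A (p + t * (a - p)).
Proof.
move=> convA Ap Aa /andP[t0 t1].
have : A (t * a + (1 - t) * p).
  by have := convA a p (Itv01 t0 t1); rewrite !inE; exact.
by congr A; ring.
Qed.

(** If the angle at the projection [p] were acute, moving from [p] towards [a]
    inside [A] would strictly decrease the distance to [y].  The sign of
    [y - p] therefore tells on which side of [y] the whole of [A] lies. *)
Lemma Proj_variational (R : realType) (A : set R) (y a : R) :
  nonempty_compact_convex A -> A a ->
  (a - Proj y A) * (y - Proj y A) <= 0.
Proof.
move=> hA Aa; have [Ap dp] := Proj_spec y hA.
set p := Proj y A in Ap dp *.
rewrite leNgt; apply/negP => acute.
have nearest t : 0 <= t <= 1 -> `|y - p| <= `|y - (p + t * (a - p))|.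
  case: hA => _ _ /convex_segment hconv t01.
  by rewrite dp dist_pt_le //; exact: hconv.
have e0 : a - p != 0 by apply: contraTneq acute => ->; rewrite mul0r ltxx.
(* Seen from [p], the points [a] and [y] are on the same side.  If [a] is
   at least as far, [A] contains [y] itself; otherwise [a] is closer to [y]
   than [p] is. *)
have [far|close] := lerP `|y - p| `|a - p|.
  have t01 : 0 <= (y - p) / (a - p) <= 1.
    have -> : (y - p) / (a - p) = ((a - p) * (y - p)) / (a - p) ^+ 2 by field.
    rewrite divr_ge0 ?sqr_ge0 ?(ltW acute)//=.
    rewrite ler_pdivrMr ?exprn_even_gt0 //= mul1r -real_normK ?num_real //.
    rewrite (le_trans (ler_norm _)) // normrM expr2 ler_wpM2l //.
  have := nearest _ t01.
  rewrite divfK // (addrC p) subrK subrr normr0 normr_le0 => /eqP yp.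
  by rewrite yp mulr0 ltxx in acute.
have := nearest 1; rewrite lexx ler01 mul1r => /(_ isT).
rewrite leNgt => /negP; apply; rewrite (addrC p) subrK.
have prodE : (a - p) * (y - p) = `|a - p| * `|y - p|.
  by rewrite -normrM gtr0_norm.
have a_pos : 0 < `|a - p| by rewrite normr_gt0.
have below : `|a - p| * `|a - p| < `|a - p| * `|y - p| by rewrite ltr_pM2l.
have sqE : `|a - p| * `|a - p| = (a - p) * (a - p).
  by rewrite -expr2 real_normK ?num_real.
rewrite -ltr_sqr ?nnegrE // !real_normK ?num_real // -subr_gt0.
have -> : (y - p) ^+ 2 - (y - a) ^+ 2 =
  2 * ((a - p) * (y - p)) - (a - p) * (a - p) by ring.
have := mulr_gt0 a_pos a_pos; rewrite prodE -sqE; lra.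
Qed.

(** Compactness enters because the real-valued supremum is an upper bound only
    of bounded sets. *)
Lemma dist_pt_le_dist (R : realType) (A B : set R) (a : R) :
  nonempty_compact_convex A -> nonempty_compact_convex B -> A a ->
  dist_pt a B <= dist A B.
Proof.
move=> [_ cA _] [[b Bb] _ _] Aa; apply: ub_le_sup; last by exists a.
have [M [_ /(_ (M + 1))]] := compact_bounded cA.
rewrite ltrDl ltr01 => /(_ isT) bA.
exists (M + 1 + `|b|) => _ [c Ac <-].
apply: le_trans (dist_pt_le _ Bb) _; apply: le_trans (ler_normB _ _) _.
by rewrite lerD2r; exact: bA.
Qed.

Lemma Lipschitz_selection (R : realType) (F : R -> set R) (L x x' y : R) :
  (forall t, nonempty_compact_convex (F t)) -> Lipschitz_map L F -> F x y ->
  exists2 y', F x' y' & `|y - y'| <= L * `|x - x'|.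
Proof.
move=> F_CC [_ F_Lip] Fy; have [Fp dp] := Proj_spec y (F_CC x').
exists (Proj y (F x')) => //; rewrite dp.
apply: le_trans (F_Lip x x'); rewrite /dist_H le_max.
by rewrite dist_pt_le_dist.
Qed.

(** * The residual of a set-valued map *)

Definition residual (R : realType) (F : R -> set R) (y t : R) : R :=
  y - Proj y (F t).

(** The trace that the relaxed one-sided Lipschitz property leaves on the
    residual: increase at rate at least [m].  Nothing is asked from a
    nonpositive value to a later nonnegative one, because the residual vanishes
    on the whole solution set, which may be an interval. *)
Definition expansive_off_zeros (R : realType) (m : R) (g : R -> R) :=
  forall s t, s <= t -> 0 < g s \/ g t < 0 -> m * (t - s) <= g t - g s.

Definition scalar_lipschitz (R : realType) (L : R) (g : R -> R) :=
  forall s t, `|g s - g t| <= L * `|s - t|.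

Section Residual.
Context {R : realType} (F : R -> set R)
  (F_CC : forall t, nonempty_compact_convex (F t)).

Lemma residual_zero (y t : R) : F t y <-> residual F y t = 0.
Proof.
have [Fp dp] := Proj_spec y (F_CC t); split=> [Fy|].
  apply/eqP; rewrite -normr_le0 dp.
  by apply: le_trans (dist_pt_le _ Fy) _; rewrite subrr normr0.
by move/eqP; rewrite subr_eq0 => /eqP ->.
Qed.

Lemma normr_residual (y t : R) : `|residual F y t| = dist_pt y (F t).
Proof. by have [] := Proj_spec y (F_CC t). Qed.

(** A positive residual means that [F t] lies entirely below [y], with its
    maximum at the projection; symmetrically for a negative residual. *)
Lemma residual_gt0 (y t z : R) :
  0 < residual F y t -> F t z -> z <= y - residual F y t.
Proof.
move=> g0 /(Proj_variational y (F_CC t)); rewrite pmulr_lle0 // /residual; lra.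
Qed.

Lemma residual_lt0 (y t z : R) :
  residual F y t < 0 -> F t z -> y - residual F y t <= z.
Proof.
move=> g0 /(Proj_variational y (F_CC t)); rewrite nmulr_lle0 // /residual; lra.
Qed.

Lemma residual_mem (y t : R) : F t (y - residual F y t).
Proof.
by have [] := Proj_spec y (F_CC t); rewrite /residual opprB addrCA subrr addr0.
Qed.

(** The difference of two distinct residuals is at most the variation of the
    upper endpoint of the interval when the larger one is positive, and of the
    lower endpoint when the smaller one is negative; one of the two always
    happens. *)
Lemma residual_lipschitz (L y : R) :
  Lipschitz_map L F -> scalar_lipschitz L (residual F y).
Proof.
move=> F_Lip; have half s t : residual F y t - residual F y s <= L * `|s - t|.
  have [t0|t0] := ltrP 0 (residual F y t).
    have [z Fz] := Lipschitz_selection t F_CC F_Lip (residual_mem y s).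
    have := residual_gt0 t0 Fz.
    rewrite ler_norml => ? /andP[_ ?]; lra.
  have [s0|s0] := ltrP (residual F y s) 0.
    have [z Fz] := Lipschitz_selection s F_CC F_Lip (residual_mem y t).
    have := residual_lt0 s0 Fz; rewrite distrC.
    rewrite (distrC t) ler_norml => ? /andP[_ ?]; lra.
  have := normr_ge0 (s - t); case: F_Lip => L0 _ ?.
  have := mulr_ge0 L0 (normr_ge0 (s - t)); lra.
move=> s t; rewrite ler_norml; apply/andP; split.
  by have := half s t; lra.
by have := half t s; rewrite distrC.
Qed.

(** The one-sided estimate is applied to a projection, and the point that it
    provides is compared with the extremal point of the other interval; the
    sign hypothesis says which interval must have an extremal projection. *)
Lemma residual_expansive (l y : R) :
  ROSL l F -> expansive_off_zeros (- l) (residual F y).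
Proof.
move=> F_ROSL s t; rewrite le_eqVlt => /predU1P[->|st] sgn.
  by rewrite !subrr mulr0.
have dst : 0 < t - s by rewrite subr_gt0.
have sq : `|t - s| ^+ 2 = (t - s) * (t - s) by rewrite real_normK ?num_real.
case: sgn => [s0|t0].
  have [z Fz] := F_ROSL t s _ (residual_mem y t).
  rewrite sq mulrA ler_pM2r //.
  have := residual_gt0 s0 Fz; lra.
have [z Fz] := F_ROSL s t _ (residual_mem y s).
rewrite distrC sq -(opprB t s) mulrN mulrA -mulNr ler_pM2r //.
have := residual_lt0 t0 Fz; lra.
Qed.

(** Both properties compare the residuals at [0] and [1].  The estimate from
    below needs a positive residual at [0], so the target is taken above the
    whole compact set [F 0]. *)
Lemma ROSL_constant_le (l L : R) :
  ROSL l F -> Lipschitz_map L F -> - l <= L.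
Proof.
move=> F_ROSL F_Lip; have [_ cF _] := F_CC 0.
have [M [_ /(_ (M + 1))]] := compact_bounded cF.
rewrite ltrDl ltr01 => /(_ isT) bF.
have pos : 0 < residual F (M + 2) 0.
  have [Fp _] := Proj_spec (M + 2) (F_CC 0).
  have := bF _ Fp; rewrite /= ler_norml /residual => /andP[_ ?]; lra.
have := residual_expansive F_ROSL ler01 (or_introl pos).
have := residual_lipschitz (M + 2) F_Lip 1 0.
rewrite subr0 normr1 !mulr1 ler_norml => /andP[_ ?] ?; lra.
Qed.

End Residual.

(** * One step of the scalar iteration *)

Section ScalarStep.
Context {R : realType}.
Implicit Types (g : R -> R) (m L : R).

(** The class of functions under study is stable under the odd reflection,
    which exchanges the two signs of the residual; the results on one step need
    only be proved at points where [g] is nonnegative. *)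
Lemma scalar_lipschitz_reflect L g :
  scalar_lipschitz L g -> scalar_lipschitz L (fun t => - g (- t)).
Proof.
move=> h s t; have := h (- t) (- s); rewrite opprK (addrC (- t)).
by rewrite opprK (addrC (- _)).
Qed.

Lemma expansive_reflect m g :
  expansive_off_zeros m g -> expansive_off_zeros m (fun t => - g (- t)).
Proof.
move=> h s t st sgn; have := h (- t) (- s).
rewrite lerN2 st => /(_ isT).
have : 0 < g (- t) \/ g (- s) < 0 by case: sgn => ?; [right|left]; lra.
move=> /[swap] /[apply]; lra.
Qed.

Lemma scalar_lipschitz_continuous L g : scalar_lipschitz L g -> continuous g.
Proof.
move=> h t; apply/cvgrPdist_le => e e0.
have L1 : 0 < `|L| + 1 by rewrite ltr_wpDl.
near=> s.
apply: le_trans (h _ _) _.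
apply: (@le_trans _ _ ((`|L| + 1) * `|t - s|)).
  by rewrite ler_wpM2r // (le_trans (ler_norm _)) // lerDl.
rewrite mulrC -ler_pdivlMr //.
near: s; apply: cvgr_dist_le; [exact: cvg_id | exact: divr_gt0].
Unshelve. all: end_near. Qed.

(** Say [0 < g x], so that the step goes left.  Without overshoot the residual
    is still positive and has decreased at rate at least [m]; it is then at
    most [(1 - m / L) / 2] times the old one.  With overshoot the Lipschitz
    bound leaves at most [(L / m - 1) / 2] times the old one on the negative
    side.  The second factor is the larger by the arithmetic-geometric mean
    inequality [2 <= m / L + L / m]. *)
Lemma residual_contraction m L g x : 0 < m -> m <= L ->
  scalar_lipschitz L g -> expansive_off_zeros m g ->
  `|g (x - (m^-1 + L^-1) / 2 * g x)| <= (L / m - 1) / 2 * `|g x|.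
Proof.
move=> m0 mL; wlog g0 : g x / 0 <= g x.
  move=> pos glip gexp; have [/pos|/ltW g0] := lerP 0 (g x); first exact.
  have := pos (fun t => - g (- t)) (- x).
  rewrite opprK oppr_ge0 => /(_ g0 (scalar_lipschitz_reflect glip)
    (expansive_reflect gexp)).
  by rewrite !normrN mulrN opprB opprK addrC.
move=> glip gexp; set r := g x in g0 *; rewrite (ger0_norm g0).
set c := (m^-1 + L^-1) / 2; set s := x - c * r.
have L0 : 0 < L by exact: lt_le_trans mL.
have c0 : 0 <= c by rewrite divr_ge0 // addr_ge0 // invr_ge0 ltW.
have xs : x - s = c * r by rewrite /s; ring.
have Lc : L * (c * r) = (L / m + 1) / 2 * r.
  by rewrite /c; field; rewrite !gt_eqF.
have mc : m * (c * r) = (1 + m / L) / 2 * r.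
  by rewrite /c; field; rewrite !gt_eqF.
have amgm : 2 * r <= (m / L + L / m) * r.
  rewrite ler_wpM2r // -subr_ge0.
  have -> : m / L + L / m - 2 = (L - m) ^+ 2 / (L * m).
    by field; rewrite !gt_eqF.
  by rewrite divr_ge0 ?sqr_ge0 // mulr_ge0 // ltW.
have := glip x s; rewrite -/r xs (ger0_norm (mulr_ge0 c0 g0)) Lc.
rewrite ler_norml => /andP[_ lower].
rewrite ler_norml; apply/andP; split; first lra.
have [gs|gs] := ltrP 0 (g s); last first.
  have : 0 <= (L / m - 1) / 2 * r; last lra.
  by rewrite !mulr_ge0 // ?invr_ge0 // subr_ge0 ler_pdivlMr // mul1r.
have := gexp s x; rewrite -subr_ge0 xs mulr_ge0 // => /(_ isT (or_introl gs)).
rewrite mc -/r; lra.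
Qed.

(** Say [0 < g x]. The rate [m] forces [g] to vanish within [g x / m] to the
    left of [x], and the rate [L] forbids a zero closer than [g x / L]. The
    step leads to the midpoint of the resulting interval, so it misses the
    zero by at most half the length, [(1 / m - 1 / L) / 2 * g x], which is
    simply bounded by [g x / (2 * m)]. *)
Lemma zero_near_step m L g x : 0 < m -> m <= L ->
  scalar_lipschitz L g -> expansive_off_zeros m g ->
  exists2 s, g s = 0 & `|x - (m^-1 + L^-1) / 2 * g x - s| <= `|g x| / (2 * m).
Proof.
move=> m0 mL; wlog g0 : g x / 0 <= g x.
  move=> pos glip gexp; have [/pos|/ltW g0] := lerP 0 (g x); first exact.
  have := pos (fun t => - g (- t)) (- x).
  rewrite opprK oppr_ge0 => /(_ g0 (scalar_lipschitz_reflect glip)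
    (expansive_reflect gexp)).
  case=> s /eqP; rewrite oppr_eq0 => /eqP gs h; exists (- s) => //.
  move: h; rewrite normrN.
  by congr (_ <= _); rewrite -normrN; congr `|_|; ring.
move=> glip gexp; set r := g x in g0 *; rewrite (ger0_norm g0).
have L0 : 0 < L by exact: lt_le_trans mL.
have lex : x - r / m <= x by rewrite gerBl divr_ge0 // ltW.
have below : g (x - r / m) <= 0.
  rewrite leNgt; apply/negP => gs.
  have := gexp _ _ lex (or_introl gs); rewrite -/r.
  have -> : m * (x - (x - r / m)) = r by field; rewrite gt_eqF.
  lra.
have [s] : exists2 s, s \in `[x - r / m, x] & g s = 0.
  apply: IVT => //.
    exact/continuous_subspaceT/scalar_lipschitz_continuous/glip.
  by rewrite ge_min below le_max g0 orbT.
rewrite in_itv /= => /andP[s1 s2] gs; exists s => //.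
have := glip x s; rewrite gs subr0 -/r (ger0_norm g0).
rewrite (@ger0_norm _ (x - s)) ?subr_ge0 //.
rewrite -ler_pdivrMl // => rL.
have rL0 : 0 <= L^-1 * r by rewrite mulr_ge0 // invr_ge0 ltW.
have e1 : (m^-1 + L^-1) / 2 * r = (r / m + L^-1 * r) / 2 by ring.
have e2 : r / (2 * m) = r / m / 2 by field; rewrite gt_eqF.
rewrite e1 e2 ler_norml; apply/andP; split; lra.
Qed.

End ScalarStep.

(** * Sequences with geometrically decaying increments *)

Lemma geometric_increments_cvg (R : realType) (x : nat -> R) (D q : R) :
  0 <= q < 1 -> (forall n, `|x n.+1 - x n| <= D * q ^+ n) ->
  exists2 xbar, x n @[n --> \oo] --> xbar
    & forall n, `|x n - xbar| <= D * (q ^+ n / (1 - q)).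
Proof.
move=> /andP[q0 q1] inc.
have D0 : 0 <= D by have := inc 0%N; rewrite expr0 mulr1; exact: le_trans.
have q'0 : 0 < 1 - q by rewrite subr_gt0.
have tail n k : `|x n - x (n + k)%N| <= D * ((q ^+ n - q ^+ (n + k)) / (1 - q)).
  elim: k => [|k IH]; first by rewrite addn0 !subrr normr0 mul0r mulr0.
  rewrite addnS -[x n](subrK (x (n + k)%N)) -addrA.
  apply: le_trans (ler_normD _ _) _.
  apply: le_trans (lerD IH _) _; first by rewrite distrC; exact: inc.
  rewrite le_eqVlt; apply/orP; left; apply/eqP; rewrite exprS.
  by field; exact: lt0r_neq0.
have cvgx : cvgn x.
  have -> : x = (fun n => x 0%N + series (telescope x) n).
    exact/funext/eq_sum_telescope.
  apply: is_cvgD; first exact: is_cvg_cst.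
  apply: normed_cvg.
  apply: (@series_le_cvg _ _ (geometric D q)) => //.
  - by move=> n /=; exact: normr_ge0.
  - by move=> n /=; exact: geometric_ge0.
  - by apply: is_cvg_geometric_series; rewrite ger0_norm.
exists (limn x) => // n.
have cn : `|x n - x p| @[p --> \oo] --> `|x n - limn x|.
  by apply: cvg_norm; apply: cvgB; [exact: cvg_cst|].
rewrite -(cvg_lim _ cn) //; apply: limr_le.
  by apply/cvg_ex; eexists; exact: cn.
near=> p; have np : (n <= p)%N by near: p; exact: nbhs_infty_ge.
rewrite -(subnKC np); apply: le_trans (tail _ _) _.
by rewrite ler_wpM2l // ler_pM2r ?invr_gt0 // gerBl exprn_ge0.
Unshelve. all: end_near. Qed.

(** * Convergence of the projection iteration *)

Theorem proposition11 (R : realType) (F : R -> set R) (l L x0 ybar : R)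
    (x : nat -> R)
    (F_CC : forall t, nonempty_compact_convex (F t))
    (l_lt0 : l < 0)
    (F_ROSL : ROSL l F)
    (F_Lip : Lipschitz_map L F)
    (L_le : L <= - 2 * l)
    (x_init : x 0%N = x0)
    (x_step : forall n, x n.+1 =
       x n + 1 / 2 * (1 / l - 1 / L) * (ybar - Proj ybar (F (x n)))) :
  let kappa := - (1 / 2) * (1 + L / l) in
  exists xbar : R,
    [/\ solution_set F ybar xbar,
        x n @[n --> \oo] --> xbar
      & forall n : nat, (1 <= n)%N ->
          dist_pt (x n) (solution_set F ybar)
            <= - (1 / (2 * l)) * kappa ^+ (n - 1) * dist_pt ybar (F x0)
          /\ `|x n - xbar|
            <= 1 / 2 * (1 / L - 1 / l) * (kappa ^+ n / (1 - kappa))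
               * dist_pt ybar (F x0)].
Proof.
move=> kappa; set m := - l; have m0 : 0 < m by rewrite oppr_gt0.
have mL : m <= L by exact: ROSL_constant_le F_ROSL F_Lip.
have L0 : 0 < L := lt_le_trans m0 mL.
set g := residual F ybar; set c := (m^-1 + L^-1) / 2.
have glip : scalar_lipschitz L g by exact: residual_lipschitz.
have gexp : expansive_off_zeros m g by exact: residual_expansive.
have kE : kappa = (L / m - 1) / 2.
  by rewrite /kappa /m; field; rewrite lt_eqF.
have k0 : 0 <= kappa.
  by rewrite kE divr_ge0 // subr_ge0 ler_pdivlMr // mul1r.
have k1 : kappa < 1.
  have : L / m <= 2 by rewrite ler_pdivrMr // /m mulrN -mulNr.
  rewrite kE; lra.
have c0 : 0 <= c by rewrite divr_ge0 // addr_ge0 // invr_ge0 ltW.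
have step n : x n.+1 = x n - c * g (x n).
  rewrite x_step -[ybar - _]/(g (x n)) /c /m; field.
  by rewrite (lt_eqF l_lt0) (gt_eqF L0).
have decay n : `|g (x n)| <= kappa ^+ n * `|g x0|.
  elim: n => [|n IH]; first by rewrite x_init expr0 mul1r.
  rewrite step; apply: le_trans (residual_contraction _ m0 mL glip gexp) _.
  by rewrite -kE exprS -mulrA ler_wpM2l.
have inc n : `|x n.+1 - x n| <= c * `|g x0| * kappa ^+ n.
  rewrite step addrC addKr normrN normrM (ger0_norm c0) -mulrA ler_wpM2l //.
  by rewrite mulrC.
have [xbar cvgx err] := geometric_increments_cvg (introT andP (conj k0 k1)) inc.
have gbar : g xbar = 0.
  have cg : g (x n) @[n --> \oo] --> g xbar.
    by apply: continuous_cvg => //; exact: (scalar_lipschitz_continuous glip).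
  apply: (@cvg_unique _ _ (g (x n) @[n --> \oo])) cg _ => //.
  apply: norm_cvg0.
  apply: (@squeeze_cvgr _ _ _ _ (cst 0) (geometric `|g x0| kappa)).
  - by near=> n; rewrite normr_ge0 /= mulrC.
  - exact: cvg_cst.
  - by apply: cvg_geometric; rewrite ger0_norm.
exists xbar; split=> //; first exact/(residual_zero F_CC).
move=> [//|n] _; rewrite -(normr_residual F_CC) -/g; split.
  have [s gs sle] := zero_near_step (x n) m0 mL glip gexp.
  have sol : solution_set F ybar s by exact/(residual_zero F_CC).
  apply: le_trans (dist_pt_le _ sol) _; rewrite step; apply: le_trans sle _.
  have -> : - (1 / (2 * l)) = (2 * m)^-1 by rewrite /m; field; rewrite lt_eqF.
  rewrite subn1 /= mulrC -mulrA ler_wpM2l ?decay //.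
  by rewrite invr_ge0 mulr_ge0 // ltW.
have -> : 1 / 2 * (1 / L - 1 / l) = c.
  by rewrite /c /m; field; rewrite (lt_eqF l_lt0) (gt_eqF L0).
by rewrite mulrAC; exact: err.
Unshelve. all: end_near. Qed.
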